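(* (i) Let $(\mathcal A,[\cdot,\cdot],\mu,\alpha)$ be a noncommutative Hom-Poisson superalgebra, let $(\mathcal A,\circ,\alpha)$ be a compatible Hom-anti-pre-Lie superalgebra of $(\mathcal A,[\cdot,\cdot],\alpha)$, and let $(\mathcal A,\prec,\succ,\alpha)$ be a compatible Hom-anti-dendriform superalgebra of $(\mathcal A,\mu,\alpha)$. If $(\mathcal A,-\mathfrak L_\circ,-\mathfrak L_\prec,-\mathfrak R_\succ,\alpha)$ is a representation of $(\mathcal A,[\cdot,\cdot],\mu,\alpha)$, then $(\mathcal A,\circ,\prec,\succ,\alpha)$ is a noncommutative Hom-anti-pre-Poisson superalgebra. (ii) Conversely, let $(\mathcal A,\circ,\prec,\succ,\alpha)$ be a noncommutative Hom-anti-pre-Poisson superalgebra, let $(\mathcal A,[\cdot,\cdot],\alpha)$ be the sub-adjacent Hom-Lie superalgebra of $(\mathcal A,\circ,\alpha)$ and let $(\mathcal A,\mu,\alpha)$ be the sub-adjacent Hom-associative superalgebra of $(\mathcal A,\prec,\succ,\alpha)$. Then $(\mathcal A,[\cdot,\cdot],\mu,\alpha)$ is a noncommutative Hom-Poisson superalgebra with a representation $(\mathcal A,-\mathfrak L_\circ,-\mathfrak L_\prec,-\mathfrak R_\succ,\alpha)$. In this case $(\mathcal A,[\cdot,\cdot],\mu,\alpha)$ is called the sub-adjacent (noncommutative) Hom-Poisson superalgebra of $(\mathcal A,\circ,\prec,\succ,\alpha)$, and $(\mathcal A,\circ,\prec,\succ,\alpha)$ is called a compatible (noncommutative) Hom-anti-pre-Poisson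 superalgebra of $(\mathcal A,[\cdot,\cdot],\mu,\alpha)$.
   Context: All vector spaces are finite-dimensional over a field $\mathbb F$ of characteristic $0$ and $\mathbb Z_2$-graded; $|x|$ is the degree of a homogeneous element; all structure maps are even and (bi)linear; all identities are required for homogeneous elements. In representations, $V$ is a $\mathbb Z_2$-graded vector space, $\beta:V\to V$ is even linear, and $\rho,\mathfrak l,\mathfrak r:\mathcal A\to\mathrm{End}(V)$ are even linear. Hom-Lie superalgebra $(\mathcal A,[\cdot,\cdot],\alpha)$: $[x,y]=-(-1)^{|x||y|}[y,x]$ and $[\alpha(x),[y,z]]=[[x,y],\alpha(z)]+(-1)^{|x||y|}[\alpha(y),[x,z]]$. Representation $(V,\rho,\beta)$: $\rho(\alpha(x))\beta=\beta\rho(x)$, $\rho([x,y])\beta=\rho(\alpha(x))\rho(y)-(-1)^{|x||y|}\rho(\alpha(y))\rho(x)$. Hom-associative superalgebra $(\mathcal A,\mu,\alpha)$: $\mu(\mu(x,y),\alpha(z))=\mu(\alpha(x),\mu(y,z))$. Representation $(V,\mathfrak l,\mathfrak r,\beta)$: $\beta\mathfrak l(x)=\mathfrak l(\alpha(x))\beta$; $\beta\mathfrak r(x)=\mathfrak r(\alpha(x))\beta$; $\mathfrak l(\mu(x,y))\beta=\mathfrak l(\alpha(x))\mathfrak l(y)$; $\mathfrak r(\mu(x,y))\beta=(-1)^{|x||y|}\mathfrak r(\alpha(y))\mathfrak r(x)$; $\mathfrak l(\alpha(x))\mathfrak r(y)=(-1)^{|x||y|}\mathfrak r(\alpha(y))\mathfrak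 l(x)$. Noncommutative Hom-Poisson superalgebra $(\mathcal A,[\cdot,\cdot],\mu,\alpha)$: $(\mathcal A,[\cdot,\cdot],\alpha)$ is a Hom-Lie superalgebra, $(\mathcal A,\mu,\alpha)$ is a Hom-associative superalgebra, and $[\alpha(x),\mu(y,z)]=\mu([x,y],\alpha(z))+(-1)^{|x||y|}\mu(\alpha(y),[x,z])$. Representation $(V,\rho,\mathfrak l,\mathfrak r,\beta)$: $(V,\rho,\beta)$ is a representation of the Hom-Lie superalgebra, $(V,\mathfrak l,\mathfrak r,\beta)$ is a representation of the Hom-associative superalgebra, and $\mathfrak l([x,y])\beta=\rho(\alpha(x))\mathfrak l(y)-(-1)^{|x||y|}\mathfrak l(\alpha(y))\rho(x)$, $\mathfrak r([x,y])\beta=\rho(\alpha(x))\mathfrak r(y)-(-1)^{|x||y|}\mathfrak r(\alpha(y))\rho(x)$, $\rho(\mu(x,y))\beta=\mathfrak l(\alpha(x))\rho(y)+(-1)^{|x||y|}\mathfrak r(\alpha(y))\rho(x)$. Hom-anti-pre-Lie superalgebra $(\mathcal A,\circ,\alpha)$: with $[x,y]_\circ=x\circ y-(-1)^{|x||y|}y\circ x$, $\alpha(x)\circ(y\circ z)-(-1)^{|x||y|}\alpha(y)\circ(x\circ z)=(-1)^{|x||y|}[y,x]_\circ\circ\alpha(z)$ and $(-1)^{|x||z|}[x,y]_\circ\circ\alpha(z)+(-1)^{|x||y|}[y,z]_\circ\circ\alpha(x)+(-1)^{|y||z|}[z,x]_\circ\circ\alpha(y)=0$. Its sub-adjacent Hom-Lie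 superalgebra is $(\mathcal A,[\cdot,\cdot]_\circ,\alpha)$; $(\mathcal A,\circ,\alpha)$ is compatible with $(\mathcal A,[\cdot,\cdot],\alpha)$ if $[\cdot,\cdot]=[\cdot,\cdot]_\circ$. Hom-anti-dendriform superalgebra $(\mathcal A,\prec,\succ,\alpha)$: with $x\cdot y=x\prec y+x\succ y$, $\alpha(x)\prec(y\prec z)=-(x\cdot y)\prec\alpha(z)=-\alpha(x)\succ(y\cdot z)=(x\succ y)\succ\alpha(z)$ and $(x\prec y)\succ\alpha(z)=\alpha(x)\prec(y\succ z)$. Its sub-adjacent Hom-associative superalgebra is $(\mathcal A,\cdot,\alpha)$; it is compatible with $(\mathcal A,\mu,\alpha)$ if $\mu(x,y)=x\cdot y$. Notation: $\mathfrak L_\circ(x)y=x\circ y$, $\mathfrak L_\prec(x)y=x\prec y$, $\mathfrak R_\succ(x)y=(-1)^{|x||y|}y\succ x$. Noncommutative Hom-anti-pre-Poisson superalgebra $(\mathcal A,\circ,\prec,\succ,\alpha)$: $(\mathcal A,\circ,\alpha)$ is a Hom-anti-pre-Lie superalgebra, $(\mathcal A,\prec,\succ,\alpha)$ is a Hom-anti-dendriform superalgebra, and $(x\circ y-(-1)^{|x||y|}y\circ x)\prec\alpha(z)=-\alpha(x)\circ(y\prec z)+(-1)^{|x||y|}\alpha(y)\prec(x\circ z)$, $\alpha(x)\succ(y\circ z-(-1)^{|y||z|}z\circ y)=-(-1)^{|x||y|}\alpha(y)\circ(x\succ z)+(-1)^{|x||y|}(y\circ x)\succ\alpha(z)$,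 $(x\prec y+x\succ y)\circ\alpha(z)=-\alpha(x)\prec(y\circ z)-(-1)^{|y||z|}(x\circ z)\succ\alpha(y)$, $\alpha(x)\circ(y\prec z+y\succ z)-(-1)^{|x|(|y|+|z|)}(y\prec z+y\succ z)\circ\alpha(x)-(-1)^{|x||y|}\alpha(y)\prec(x\circ z)-(x\circ y)\succ\alpha(z)=0$.
   Formalization: In (ii), the representation claim is proved assuming α is multiplicative for ∘, ≺ and ≻; without this it is false (e∘e=f, other products 0, α(e)=e, α(f)=2f), and the representation's twist conditions are equivalent to it. *)

(* Defs.v *)
From HB Require Import structures.
From mathcomp Require Import all_boot all_order all_algebra.

Set Implicit Arguments.
Unset Strict Implicit.
Unset Printing Implicit Defensive.

Import GRing.Theory.

Local Open Scope ring_scope.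
Local Open Scope lfun_scope.

(* A bilinear map A x V -> V (a product on A, or a linear action of A on V) is
   an element of 'Hom(A, 'End(V)); in particular a product [mu] on A is its own
   left multiplication: [mu x] is the operator y |-> mu x y.
   Degrees are booleans: [false] is even, [true] is odd, and degrees are added
   with (+), i.e., addb. *)

Section SuperSpaces.
Variable F : fieldType.

Record grading (V : vectType F) := Grading {
  homog :> bool -> {vspace V};
  grading_full : (homog false + homog true)%VS = fullv;
  grading_direct : (homog false :&: homog true)%VS = 0%VS }.

(* The Koszul sign (-1)^(|x||y|). *)
Definition ksign (i j : bool) : F := (-1) ^+ (i && j).

Definition even_lin (V : vectType F) (gV : grading V) (f : 'End(V)) : Prop :=
  forall i, {in gV i, forall v, f v \in gV i}.

(* When V = A this says that a product on A is even; in general, it says that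
   x |-> rho x is an even map from A to End(V) with its induced grading. *)
Definition even_bilin (A V : vectType F) (gA : grading A) (gV : grading V)
    (rho : 'Hom(A, 'End(V))) : Prop :=
  forall i j, {in gA i & gV j, forall x v, rho x v \in gV (i (+) j)}.

Variables (A : vectType F) (g : grading A).

Definition hcomp (i : bool) : 'End(A) := daddv_pi (g i) (g (~~ i)).

(* The operation R_mu(x) y = (-1)^(|x||y|) mu y x for homogeneous x and y,
   extended bilinearly to A; see [rmulE]. *)
Definition rmul_fun (mu : 'Hom(A, 'End(A))) (x y : A) : A :=
  \sum_(i : bool) \sum_(j : bool) ksign i j *: mu (hcomp j y) (hcomp i x).

Definition rmul_op (mu : 'Hom(A, 'End(A))) (x : A) : 'End(A) :=
  linfun (rmul_fun mu x).

Definition rmul (mu : 'Hom(A, 'End(A))) : 'Hom(A, 'End(A)) :=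
  linfun (rmul_op mu).

(* [x, y] = mu x y - (-1)^(|x||y|) mu y x. *)
Definition scomm (mu : 'Hom(A, 'End(A))) : 'Hom(A, 'End(A)) := mu - rmul mu.

Fact rmul_fun_linear mu x : linear (rmul_fun mu x).
Proof.
move=> a u v; rewrite /rmul_fun scaler_sumr -big_split; apply: eq_bigr => i _ /=.
rewrite scaler_sumr -big_split; apply: eq_bigr => j _ /=.
by rewrite !linearP add_lfunE scale_lfunE scalerDr !scalerA mulrC.
Qed.

HB.instance Definition _ mu x :=
  GRing.isLinear.Build F A A _ (rmul_fun mu x) (@rmul_fun_linear mu x).

Fact rmul_op_linear mu : linear (rmul_op mu).
Proof.
move=> a u v; apply/lfunP => y; rewrite /rmul_op.
rewrite add_lfunE scale_lfunE !lfunE /= /rmul_fun scaler_sumr -big_split.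
apply: eq_bigr => i _ /=; rewrite scaler_sumr -big_split.
apply: eq_bigr => j _ /=.
by rewrite !linearP.
Qed.

HB.instance Definition _ mu :=
  GRing.isLinear.Build F A 'End(A) _ (rmul_op mu) (@rmul_op_linear mu).

Lemma hcomp_homog i j x : x \in g i -> hcomp j x = (if i == j then x else 0).
Proof.
have dir k : (g k :&: g (~~ k) = 0)%VS.
  by case: k; rewrite ?(grading_direct g) // capvC (grading_direct g).
move=> gx; case: eqP => [<-|/eqP neq_ij]; first by rewrite /hcomp daddv_pi_id.
move: gx; have -> : i = ~~ j by case: i j neq_ij => [] [].
move=> gx; have fullD : (x \in g j + g (~~ j))%VS.
  by rewrite memvE (subv_trans _ (addvSr _ _)) // -memvE.
have := daddv_pi_add (dir j) fullD.
have dirC : (g (~~ j) :&: g j = 0)%VS by rewrite capvC.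
by rewrite (daddv_pi_id dirC gx) -[RHS]add0r => /addIr.
Qed.

Lemma rmulE mu i j : {in g i & g j, forall x y,
  rmul mu x y = ksign i j *: mu y x}.
Proof.
move=> x y gx gy; rewrite lfunE /= lfunE /= /rmul_fun.
rewrite (bigD1 i) //= (bigD1 j) //= !(hcomp_homog _ gx) !(hcomp_homog _ gy).
rewrite !eqxx big1 => [|k]; last first.
  by rewrite eq_sym (hcomp_homog _ gy) => /negPf->; rewrite linear0 lfunE scaler0.
rewrite addr0 big1 ?addr0 // => k.
rewrite eq_sym (hcomp_homog _ gx) => /negPf->.
by rewrite big1 // => l _; rewrite linear0 scaler0.
Qed.

Lemma scommE mu i j : {in g i & g j, forall x y,
  scomm mu x y = mu x y - ksign i j *: mu y x}.
Proof.
by move=> x y gx gy; rewrite /scomm add_lfunE opp_lfunE add_lfunE opp_lfunE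
  (rmulE _ gx gy).
Qed.

Implicit Types (br mu circ prec succ : 'Hom(A, 'End(A))) (al : 'End(A)).

(* Not part of any of the structures below, whose twist [al] is just an even
   linear map; for rho = - mu and be = al it is the equivariance condition
   rho (al x) \o be = be \o rho x. *)
Definition multiplicative mu al : Prop :=
  forall x y, al (mu x y) = mu (al x) (al y).

Record hom_lie br al : Prop := HomLie {
  hom_lie_even : even_bilin g g br;
  hom_lie_twist_even : even_lin g al;
  hom_lie_skew : forall i j, {in g i & g j, forall x y,
    br x y = - (ksign i j *: br y x)};
  hom_lie_jacobi : forall i j k, {in g i & g j & g k, forall x y z,
    br (al x) (br y z) = br (br x y) (al z) + ksign i j *: br (al y) (br x z)} }.

Record hom_assoc mu al : Prop := HomAssoc {
  hom_assoc_even : even_bilin g g mu;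
  hom_assoc_twist_even : even_lin g al;
  hom_assoc_law : forall i j k, {in g i & g j & g k, forall x y z,
    mu (mu x y) (al z) = mu (al x) (mu y z)} }.

Record hom_poisson br mu al : Prop := HomPoisson {
  hom_poisson_lie : hom_lie br al;
  hom_poisson_assoc : hom_assoc mu al;
  hom_poisson_leibniz : forall i j k, {in g i & g j & g k, forall x y z,
    br (al x) (mu y z)
      = mu (br x y) (al z) + ksign i j *: mu (al y) (br x z)} }.

Record hom_anti_pre_lie circ al : Prop := HomAntiPreLie {
  anti_pre_lie_even : even_bilin g g circ;
  anti_pre_lie_twist_even : even_lin g al;
  anti_pre_lie_left : forall i j k, {in g i & g j & g k, forall x y z,
    circ (al x) (circ y z) - ksign i j *: circ (al y) (circ x z)
      = ksign i j *: circ (scomm circ y x) (al z)};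
  anti_pre_lie_cyclic : forall i j k, {in g i & g j & g k, forall x y z,
    ksign i k *: circ (scomm circ x y) (al z)
      + ksign i j *: circ (scomm circ y z) (al x)
      + ksign j k *: circ (scomm circ z x) (al y) = 0} }.

Record hom_anti_dendriform prec succ al : Prop := HomAntiDendriform {
  anti_dendriform_prec_even : even_bilin g g prec;
  anti_dendriform_succ_even : even_bilin g g succ;
  anti_dendriform_twist_even : even_lin g al;
  anti_dendriform_law1 : forall i j k, {in g i & g j & g k, forall x y z,
    prec (al x) (prec y z) = - prec ((prec + succ) x y) (al z)};
  anti_dendriform_law2 : forall i j k, {in g i & g j & g k, forall x y z,
    - prec ((prec + succ) x y) (al z) = - succ (al x) ((prec + succ) y z)};
  anti_dendriform_law3 : forall i j k, {in g i & g j & g k, forall x y z,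
    - succ (al x) ((prec + succ) y z) = succ (succ x y) (al z)};
  anti_dendriform_law4 : forall i j k, {in g i & g j & g k, forall x y z,
    succ (prec x y) (al z) = prec (al x) (succ y z)} }.

Record hom_anti_pre_poisson circ prec succ al : Prop := HomAntiPrePoisson {
  anti_pre_poisson_lie : hom_anti_pre_lie circ al;
  anti_pre_poisson_dendriform : hom_anti_dendriform prec succ al;
  anti_pre_poisson_law1 : forall i j k, {in g i & g j & g k, forall x y z,
    prec (circ x y - ksign i j *: circ y x) (al z)
      = - circ (al x) (prec y z) + ksign i j *: prec (al y) (circ x z)};
  anti_pre_poisson_law2 : forall i j k, {in g i & g j & g k, forall x y z,
    succ (al x) (circ y z - ksign j k *: circ z y)
      = - (ksign i j *: circ (al y) (succ x z))
        + ksign i j *: succ (circ y x) (al z)};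
  anti_pre_poisson_law3 : forall i j k, {in g i & g j & g k, forall x y z,
    circ (prec x y + succ x y) (al z)
      = - prec (al x) (circ y z) - ksign j k *: succ (circ x z) (al y)};
  anti_pre_poisson_law4 : forall i j k, {in g i & g j & g k, forall x y z,
    circ (al x) (prec y z + succ y z)
      - ksign i (j (+) k) *: circ (prec y z + succ y z) (al x)
      - ksign i j *: prec (al y) (circ x z) - succ (circ x y) (al z) = 0} }.

Definition subadj_lie circ : 'Hom(A, 'End(A)) := scomm circ.
Definition subadj_assoc prec succ : 'Hom(A, 'End(A)) := prec + succ.

Definition compatible_lie br circ : Prop := br = subadj_lie circ.
Definition compatible_assoc mu prec succ : Prop := mu = subadj_assoc prec succ.

Section Representations.
Variables (V : vectType F) (gV : grading V).
Implicit Types (rho l r : 'Hom(A, 'End(V))) (be : 'End(V)).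

Record hom_lie_rep br al rho be : Prop := HomLieRep {
  lie_rep_even : even_bilin g gV rho;
  lie_rep_twist_even : even_lin gV be;
  lie_rep_twist : forall i, {in g i, forall x, rho (al x) \o be = be \o rho x};
  lie_rep_bracket : forall i j, {in g i & g j, forall x y,
    rho (br x y) \o be
      = (rho (al x) \o rho y) - ksign i j *: (rho (al y) \o rho x)} }.

Record hom_assoc_rep mu al l r be : Prop := HomAssocRep {
  assoc_rep_left_even : even_bilin g gV l;
  assoc_rep_right_even : even_bilin g gV r;
  assoc_rep_twist_even : even_lin gV be;
  assoc_rep_left_twist : forall i, {in g i, forall x,
    be \o l x = l (al x) \o be};
  assoc_rep_right_twist : forall i, {in g i, forall x,
    be \o r x = r (al x) \o be};
  assoc_rep_left_mul : forall i j, {in g i & g j, forall x y,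
    l (mu x y) \o be = l (al x) \o l y};
  assoc_rep_right_mul : forall i j, {in g i & g j, forall x y,
    r (mu x y) \o be = ksign i j *: (r (al y) \o r x)};
  assoc_rep_comm : forall i j, {in g i & g j, forall x y,
    l (al x) \o r y = ksign i j *: (r (al y) \o l x)} }.

Record hom_poisson_rep br mu al rho l r be : Prop := HomPoissonRep {
  poisson_rep_lie : hom_lie_rep br al rho be;
  poisson_rep_assoc : hom_assoc_rep mu al l r be;
  poisson_rep_left : forall i j, {in g i & g j, forall x y,
    l (br x y) \o be = (rho (al x) \o l y) - ksign i j *: (l (al y) \o rho x)};
  poisson_rep_right : forall i j, {in g i & g j, forall x y,
    r (br x y) \o be = (rho (al x) \o r y) - ksign i j *: (r (al y) \o rho x)};
  poisson_rep_mul : forall i j, {in g i & g j, forall x y,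
    rho (mu x y) \o be
      = (l (al x) \o rho y) + ksign i j *: (r (al y) \o rho x)} }.

End Representations.
End SuperSpaces.

(* Main.v *)
Require Import Defs.
From mathcomp Require Import all_boot all_order all_algebra.
From mathcomp Require Import ring.

Set Implicit Arguments.
Unset Strict Implicit.
Unset Printing Implicit Defensive.

Import GRing.Theory.
(* [multiplicative] is to be the predicate on products and twists, which
   [GRing.Theory] has just shadowed. *)
Import Defs.

Local Open Scope ring_scope.

(** The mixed axioms say the same thing twice.  Evaluated at a homogeneous
vector, the three compatibility axioms of a Poisson representation, for the
candidate representation (- L_circ, - L_prec, - R_succ), are the first three
laws of an anti-pre-Poisson superalgebra up to an invertible sign
([poisson_rep_leftP], [poisson_rep_rightP], [poisson_rep_mulP]); both ways this
uses only that an operator is determined by its values on homogeneous vectors.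

The fourth law is the Leibniz rule.  Write P and Q for the last two terms of
that law and B for the bracket of al x with the product of y and z, so that the
law reads B = P + Q.  In the right-hand side of the Leibniz rule, the first two
laws rewrite prec ([x, y]) (al z) and succ (al y) ([x, z]), and the third one
gathers the remaining terms into the second half of a bracket: the right-hand
side becomes - B + 2 (P + Q).  The Leibniz rule is therefore 2 (B - P - Q) = 0
([leibniz_defect]), and this is equivalent to the fourth law because 2 is
invertible.

The pure axioms are consequences of the anti-pre-Lie and the anti-dendriform
structure separately: they make the sub-adjacent products Hom-Lie and
Hom-associative ([subadj_lieP], [subadj_assocP]) and give the representations
on A by - L_circ and by (- L_prec, - R_succ) ([left_lie_rep],
[left_right_assoc_rep]).  Only the equivariance of these actions under the
twist is not of this kind: it is the multiplicativity of the twist.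

Every identity is proved as an explicit linear combination of instances of the
laws ([linear_step]); what is then left is linear in the monomials, for each
choice of degrees ([by_linearity]). *)

(** * Linear combinations of vector identities *)

Section Linearity.
Variables (F : fieldType) (A : vectType F).
Implicit Types (u v w : A) (c : F) (m : 'Hom(A, 'End(A))) (f : 'End(A)).
Implicit Types phi : {scalar A}.

(** Linear functionals turn an identity between vectors into identities between
scalars, which a ring decision procedure can settle. *)
Lemma scalar_ext u v : (forall phi, phi u = phi v) -> u = v.
Proof.
move=> eq_phi; rewrite (coord_vbasis (memvf u)) (coord_vbasis (memvf v)).
by apply: eq_bigr => i _; congr (_ *: _); apply: (eq_phi (coord _ i)).
Qed.

(* These instances of linearity have a concrete head symbol, which makes
   rewriting with them much faster than with the generic ones. *)
Lemma lfunD f u v : f (u + v) = f u + f v. Proof. exact: linearD. Qed.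
Lemma lfunN f u : f (- u) = - f u. Proof. exact: linearN. Qed.
Lemma lfunZ f c u : f (c *: u) = c *: f u. Proof. exact: linearZ. Qed.

Lemma actD m u v w : m (u + v) w = m u w + m v w.
Proof. by rewrite linearD /= add_lfunE. Qed.
Lemma actN m u w : m (- u) w = - m u w.
Proof. by rewrite linearN /= opp_lfunE. Qed.
Lemma actZ m c u w : m (c *: u) w = c *: m u w.
Proof. by rewrite linearZ /= scale_lfunE. Qed.

Lemma add_actE m m' u w : (m + m') u w = m u w + m' u w.
Proof. by rewrite !add_lfunE. Qed.
Lemma opp_actE m u w : (- m) u w = - m u w.
Proof. by rewrite !opp_lfunE. Qed.


Lemma scalarD phi u v : phi (u + v) = phi u + phi v. Proof. exact: linearD. Qed.
Lemma scalarN phi u : phi (- u) = - phi u. Proof. exact: linearN. Qed.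
Lemma scalarZ phi c u : phi (c *: u) = c * phi u. Proof. exact: linearZ. Qed.
Lemma scalar0 phi : phi 0 = 0. Proof. exact: linear0. Qed.


(** To derive [u = v] from several equations, apply this once for each of them,
with its coefficient; the difference of the two sides of the goal must end up
as the linear combination of the differences of the equations. *)
Lemma linear_step c (a b u v : A) :
  a = b -> u - v = c *: (a - b) -> u = v.
Proof. by move=> ->; rewrite subrr scaler0 => /subr0_eq. Qed.

End Linearity.

Arguments linear_step {F A} c {a b u v}.

(* Proves a vector identity that is formal in the products m u v, for all values
   of the degrees in the context.  The monomials are replaced by variables before
   they meet a functional: the same monomial can occur with different but
   convertible implicit structures, which the ring tactic would keep apart. *)
Ltac by_linearity :=
  rewrite ?add_actE ?opp_actE;
  do 2 rewrite ?actD ?actN ?actZ;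
  do 2 rewrite ?lfunD ?lfunN ?lfunZ;
  repeat match goal with
  | |- context [fun_of_lfun (fun_of_lfun ?m ?u) ?v] => move: (m u v) => ?
  end;
  let phi := fresh "phi" in
  apply: scalar_ext => phi;
  do 4 rewrite ?scalarD ?scalarN ?scalarZ;
  rewrite ?scalar0;
  repeat match goal with
  | |- context [GRing.Linear.sort phi ?t] => generalize (phi t) => ?
  end;
  repeat match goal with i : bool |- _ => destruct i end;
  rewrite /ksign /=; ring.

(** * Homogeneous evaluation and even products *)

Section Graded.
Variables (F : fieldType) (A : vectType F) (g : grading A).
Implicit Types (i j k : bool) (x y z : A).
Local Notation "s_( i , j )" := (ksign F i j) (format "s_( i ,  j )").

Lemma lfun_homogP (f h : 'End(A)) : f = h <-> forall k, {in g k, f =1 h}.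
Proof.
split=> [-> // | eq_fh]; apply/lfunP => v.
have : v \in (g false + g true)%VS by rewrite grading_full memvf.
case/memv_addP => v0 gv0 [v1 gv1 ->].
by rewrite !lfunD (eq_fh _ _ gv0) (eq_fh _ _ gv1).
Qed.

Definition evalE := (comp_lfunE, add_lfunE, opp_lfunE, scale_lfunE).

Lemma even_opp (m : 'Hom(A, 'End(A))) : even_bilin g g m -> even_bilin g g (- m).
Proof. by move=> ev i j x y gx gy; rewrite opp_actE rpredN ev. Qed.

Lemma even_add (m m' : 'Hom(A, 'End(A))) :
  even_bilin g g m -> even_bilin g g m' -> even_bilin g g (m + m').
Proof. by move=> ev ev' i j x y gx gy; rewrite add_actE rpredD ?ev ?ev'. Qed.

Lemma even_rmul (m : 'Hom(A, 'End(A))) :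
  even_bilin g g m -> even_bilin g g (rmul g m).
Proof.
by move=> ev i j x y gx gy; rewrite (rmulE _ gx gy) rpredZ // addbC ev.
Qed.

Lemma even_scomm (m : 'Hom(A, 'End(A))) :
  even_bilin g g m -> even_bilin g g (scomm g m).
Proof. by move=> ev; apply/even_add/even_opp/even_rmul. Qed.

(** * The sub-adjacent Hom-Lie superalgebra *)

Section Lie.
Variables (circ : 'Hom(A, 'End(A))) (al : 'End(A)).
Hypothesis circP : hom_anti_pre_lie g circ al.

(** Expanded into products, the Jacobi identity contains each term of the form
al x (y z) once.  The left-symmetry law, for three orders of the arguments,
turns these into terms (x y) (al z), whose total is, up to a sign, twice
the cyclic law. *)
Lemma subadj_lieP : hom_lie g (subadj_lie g circ) al.
Proof.
case: circP => ev al_ev left cyc; split=> //; first exact: even_scomm.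
  move=> i j x y gx gy.
  by rewrite /subadj_lie (scommE _ gx gy) (scommE _ gy gx); by_linearity.
move=> i j k x y z gx gy gz; rewrite /subadj_lie.
have E1 := left _ _ _ _ _ _ gx gy gz.
have E2 := left _ _ _ _ _ _ gy gz gx.
have E3 := left _ _ _ _ _ _ gx gz gy.
have E4 := cyc _ _ _ _ _ _ gx gy gz.
have brE : forall i j, {in g i & g j, forall x y, scomm g circ x y \in g (i (+) j)}
  := even_scomm ev.
rewrite (scommE _ (al_ev _ _ gx) (brE _ _ _ _ gy gz)).
rewrite (scommE _ (brE _ _ _ _ gx gy) (al_ev _ _ gz)).
rewrite (scommE _ (al_ev _ _ gy) (brE _ _ _ _ gx gz)).
move: E1 E2 E3 E4.
rewrite (scommE _ gx gy) (scommE _ gy gx) (scommE _ gx gz) (scommE _ gz gx).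
rewrite (scommE _ gy gz) (scommE _ gz gy) => E1 E2 E3 E4.
apply: (linear_step 1 E1).
apply: (linear_step (s_(i, j) * s_(i, k)) E2).
apply: (linear_step (- s_(j, k)) E3).
apply: (linear_step (- (s_(i, k) *+ 2)) E4).
by_linearity.
Qed.

(** The bracket axiom is the left-symmetry law itself: the sign of - L_circ
compensates the exchange of x and y in the bracket of that law. *)
Lemma left_lie_rep : multiplicative circ al ->
  hom_lie_rep g g (subadj_lie g circ) al (- circ) al.
Proof.
case: circP => ev al_ev left _ alM; split=> //; first exact: even_opp.
  by move=> i x gx; apply/lfunP => v; rewrite !evalE lfunN alM.
move=> i j x y gx gy; apply/(lfun_homogP _ _) => k z gz.
have := left _ _ _ _ _ _ gx gy gz.
rewrite /subadj_lie (scommE _ gx gy) (scommE _ gy gx) !evalE.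
by move/(linear_step (-1)); apply; by_linearity.
Qed.
End Lie.

(** * The sub-adjacent Hom-associative superalgebra *)

Section Assoc.
Variables (prec succ : 'Hom(A, 'End(A))) (al : 'End(A)).
Hypothesis dendP : hom_anti_dendriform g prec succ al.

(** Of the six terms of associativity after expanding the outer products and
succ (x y) (al z), prec (al x) (y z) in turn, the chain of the first three laws
cancels four in pairs, and the fourth law cancels the last two. *)
Lemma subadj_assocP : hom_assoc g (subadj_assoc prec succ) al.
Proof.
case: dendP => evp evs al_ev law1 law2 law3 law4; split=> //.
  exact: even_add.
move=> i j k x y z gx gy gz; rewrite /subadj_assoc.
have E1 := law1 _ _ _ _ _ _ gx gy gz.
have E2 := law2 _ _ _ _ _ _ gx gy gz.
have E3 := law3 _ _ _ _ _ _ gx gy gz.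
have E4 := law4 _ _ _ _ _ _ gx gy gz.
apply: (linear_step (-1) E2).
apply: (linear_step (-1) (etrans E1 (etrans E2 E3))).
apply: (linear_step 1 E4).
by_linearity.
Qed.

(** The axioms for the left action, the right action and their commutation are
the laws with innermost prec, innermost succ and mixed products.  The vector
acted on by R_succ is the leftmost factor, whence the order of the arguments in
the instances of the laws and the remaining Koszul signs. *)
Lemma left_right_assoc_rep : multiplicative prec al -> multiplicative succ al ->
  hom_assoc_rep g g (subadj_assoc prec succ) al (- prec) (- rmul g succ) al.
Proof.
case: dendP => evp evs al_ev law1 law2 law3 law4 alMp alMs.
split=> //; [exact: even_opp | exact/even_opp/even_rmul | | | | | ].
- by move=> i x gx; apply/lfunP => v; rewrite !evalE lfunN alMp.
- move=> i x gx; apply/(lfun_homogP _ _) => k z gz; rewrite !evalE.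
  rewrite (rmulE _ gx gz) (rmulE _ (al_ev _ _ gx) (al_ev _ _ gz)).
  by rewrite lfunN lfunZ alMs.
- move=> i j x y gx gy; apply/(lfun_homogP _ _) => k z gz.
  have := law1 _ _ _ _ _ _ gx gy gz; rewrite /subadj_assoc !evalE.
  by move/(linear_step (-1)); apply; by_linearity.
- move=> i j x y gx gy; apply/(lfun_homogP _ _) => k z gz.
  have gxy := even_add evp evs gx gy.
  have := law3 _ _ _ _ _ _ gz gx gy; rewrite /subadj_assoc.
  rewrite comp_lfunE opp_actE (rmulE _ gxy (al_ev _ _ gz)) !evalE lfunN.
  rewrite (rmulE _ gx gz) lfunZ (rmulE _ (al_ev _ _ gy) (evs _ _ _ _ gz gx)).
  by move/(linear_step (s_(i (+) j, k))); apply; by_linearity.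
- move=> i j x y gx gy; apply/(lfun_homogP _ _) => k z gz.
  have := law4 _ _ _ _ _ _ gx gz gy; rewrite !evalE !lfunN.
  rewrite (rmulE _ gy gz) (rmulE _ (al_ev _ _ gy) (evp _ _ _ _ gx gz)).
  by move/(linear_step (- s_(j, k))); apply; by_linearity.
Qed.

End Assoc.

(** * The mixed axioms *)

Section Poisson.
Variables (circ prec succ : 'Hom(A, 'End(A))) (al : 'End(A)).
Hypotheses (circ_even : even_bilin g g circ) (prec_even : even_bilin g g prec).
Hypotheses (succ_even : even_bilin g g succ) (al_even : even_lin g al).

Lemma poisson_rep_leftP :
  (forall i j, {in g i & g j, forall x y,
    ((- prec) (scomm g circ x y) \o al
      = ((- circ) (al x) \o (- prec) y)
        - s_(i, j) *: ((- prec) (al y) \o (- circ) x))%VF})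
  <-> forall i j k, {in g i & g j & g k, forall x y z,
    prec (circ x y - s_(i, j) *: circ y x) (al z)
      = - circ (al x) (prec y z) + s_(i, j) *: prec (al y) (circ x z)}.
Proof.
split=> law i j => [k x y z gx gy gz|x y gx gy].
  have /(lfun_homogP _ _)/(_ k z gz) := law _ _ _ _ gx gy.
  rewrite (scommE _ gx gy) !evalE.
  by move/(linear_step (-1)); apply; by_linearity.
apply/(lfun_homogP _ _) => k z gz; have := law _ _ _ _ _ _ gx gy gz.
rewrite (scommE _ gx gy) !evalE.
by move/(linear_step (-1)); apply; by_linearity.
Qed.

Lemma poisson_rep_rightP :
  (forall i j, {in g i & g j, forall x y,
    ((- rmul g succ) (scomm g circ x y) \o al
      = ((- circ) (al x) \o (- rmul g succ) y)
        - s_(i, j) *: ((- rmul g succ) (al y) \o (- circ) x))%VF})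
  <-> forall i j k, {in g i & g j & g k, forall x y z,
    succ (al x) (circ y z - s_(j, k) *: circ z y)
      = - (s_(i, j) *: circ (al y) (succ x z))
        + s_(i, j) *: succ (circ y x) (al z)}.
Proof.
(* R_succ puts the vector acted on first, so the operator identity for the pair
   (y, z) evaluated at x gives the law for (x, y, z). *)
have evalP i j k x y z : x \in g i -> y \in g j -> z \in g k ->
    (((- rmul g succ) (scomm g circ y z) \o al)%VF x
      = (((- circ) (al y) \o (- rmul g succ) z)
        - s_(j, k) *: ((- rmul g succ) (al z) \o (- circ) y))%VF x) <->
    succ (al x) (circ y z - s_(j, k) *: circ z y)
      = - (s_(i, j) *: circ (al y) (succ x z))
        + s_(i, j) *: succ (circ y x) (al z).
  move=> gx gy gz; have := even_scomm circ_even gy gz.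
  rewrite (scommE _ gy gz) => gyz; rewrite !evalE !lfunN.
  rewrite (rmulE _ gyz (al_even gx)) (rmulE _ gz gx).
  rewrite (rmulE _ (al_even gz) (circ_even gy gx)).
  by split=> /(linear_step (- s_(i, j (+) k))); apply; by_linearity.
split=> law i j => [k x y z gx gy gz|y z gy gz].
  by apply/(evalP i j k) => //; rewrite (law _ _ _ _ gy gz).
apply/(lfun_homogP _ _) => k x gx.
by apply/(evalP k i j) => //; apply: law.
Qed.

Lemma poisson_rep_mulP :
  (forall i j, {in g i & g j, forall x y,
    ((- circ) ((prec + succ) x y) \o al
      = ((- prec) (al x) \o (- circ) y)
        + s_(i, j) *: ((- rmul g succ) (al y) \o (- circ) x))%VF})
  <-> forall i j k, {in g i & g j & g k, forall x y z,
    circ (prec x y + succ x y) (al z)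
      = - prec (al x) (circ y z) - s_(j, k) *: succ (circ x z) (al y)}.
Proof.
split=> law i j => [k x y z gx gy gz|x y gx gy].
  have /(lfun_homogP _ _)/(_ k z gz) := law _ _ _ _ gx gy.
  rewrite !evalE !lfunN (rmulE _ (al_even gy) (circ_even gx gz)).
  by move/(linear_step (-1)); apply; by_linearity.
apply/(lfun_homogP _ _) => k z gz; have := law _ _ _ _ _ _ gx gy gz.
rewrite !evalE !lfunN (rmulE _ (al_even gy) (circ_even gx gz)).
by move/(linear_step (-1)); apply; by_linearity.
Qed.

(** Given the first three laws at suitable arguments, the two sides of the
Leibniz rule differ by twice the left-hand side of the fourth law: rewriting
with these laws makes the bracket reappear with the opposite sign on the right
of the Leibniz rule. *)
Lemma leibniz_defect i j k x y z : x \in g i -> y \in g j -> z \in g k ->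
  prec (circ x y - s_(i, j) *: circ y x) (al z)
    = - circ (al x) (prec y z) + s_(i, j) *: prec (al y) (circ x z) ->
  succ (al y) (circ x z - s_(i, k) *: circ z x)
    = - (s_(j, i) *: circ (al x) (succ y z))
      + s_(j, i) *: succ (circ x y) (al z) ->
  circ (prec y z + succ y z) (al x)
    = - prec (al y) (circ z x) - s_(k, i) *: succ (circ y x) (al z) ->
  scomm g circ (al x) ((prec + succ) y z)
      - ((prec + succ) (scomm g circ x y) (al z)
         + s_(i, j) *: (prec + succ) (al y) (scomm g circ x z))
    = 2 *: (circ (al x) (prec y z + succ y z)
        - s_(i, j (+) k) *: circ (prec y z + succ y z) (al x)
        - s_(i, j) *: prec (al y) (circ x z) - succ (circ x y) (al z)).
Proof.
move=> gx gy gz E1 E2 E3.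
have gyz := even_add prec_even succ_even gy gz.
rewrite (scommE _ (al_even gx) gyz) (scommE _ gx gy) (scommE _ gx gz).
apply: (linear_step (-1) E1).
apply: (linear_step (- s_(i, j)) E2).
apply: (linear_step s_(i, j (+) k) E3).
by_linearity.
Qed.

End Poisson.
End Graded.

Theorem proposition4p1 (F : fieldType) (charF0 : [pchar F] =i pred0)
    (A : vectType F) (g : grading A) :
  (forall (br mu circ prec succ : 'Hom(A, 'End(A))) (al : 'End(A)),
     hom_poisson g br mu al ->
     hom_anti_pre_lie g circ al -> compatible_lie g br circ ->
     hom_anti_dendriform g prec succ al -> compatible_assoc mu prec succ ->
     hom_poisson_rep g g br mu al (- circ) (- prec) (- rmul g succ) al ->
     hom_anti_pre_poisson g circ prec succ al)
  /\
  (forall (circ prec succ : 'Hom(A, 'End(A))) (al : 'End(A)),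
     hom_anti_pre_poisson g circ prec succ al ->
     hom_poisson g (subadj_lie g circ) (subadj_assoc prec succ) al /\
     (multiplicative circ al -> multiplicative prec al ->
      multiplicative succ al ->
      hom_poisson_rep g g (subadj_lie g circ) (subadj_assoc prec succ) al
        (- circ) (- prec) (- rmul g succ) al)).
Proof.
split=> [br mu circ prec succ al [_ _ leibniz] circP br_eq dendP mu_eq rep
        | circ prec succ al poissonP].
  move: leibniz rep; rewrite br_eq mu_eq => leibniz [_ _ repl repr repm].
  have [cev al_ev _ _] := circP; have [pev sev _ _ _ _ _] := dendP.
  have law1 := (poisson_rep_leftP _ _ _ _).1 repl.
  have law2 := (poisson_rep_rightP _ cev al_ev).1 repr.
  have law3 := (poisson_rep_mulP _ _ cev al_ev).1 repm.
  split=> // i j k x y z gx gy gz.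
  have := leibniz_defect pev sev al_ev gx gy gz (law1 _ _ _ _ _ _ gx gy gz)
    (law2 _ _ _ _ _ _ gy gx gz) (law3 _ _ _ _ _ _ gy gz gx).
  rewrite (leibniz _ _ _ _ _ _ gx gy gz) subrr => /esym/eqP.
  (* Characteristic zero allows dividing by 2. *)
  by rewrite scaler_eq0 (pcharf0P F).1 // => /eqP.
have [circP dendP law1 law2 law3 law4] := poissonP.
have [cev al_ev _ _] := circP; have [pev sev _ _ _ _ _] := dendP.
split=> [|alMc alMp alMs].
  split; [exact: subadj_lieP | exact: subadj_assocP |].
  move=> i j k x y z gx gy gz; apply/subr0_eq.
  rewrite (leibniz_defect pev sev al_ev gx gy gz (law1 _ _ _ _ _ _ gx gy gz)
    (law2 _ _ _ _ _ _ gy gx gz) (law3 _ _ _ _ _ _ gy gz gx)).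
  by rewrite (law4 _ _ _ _ _ _ gx gy gz) scaler0.
split; first exact: left_lie_rep; first exact: left_right_assoc_rep.
- exact/poisson_rep_leftP.
- exact/poisson_rep_rightP.
- exact/poisson_rep_mulP.
Qed.
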